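(* Let $q$ be a prime power and $n\ge2$. There are exactly $$(q-1)^nq^{n(n-1)}=\left(1-\frac1q\right)^nq^{n^2}$$ nonsingular $n\times n$ matrices $M$ over $\mathrm{GF}(q)$ which can be computed simply by updating their rows from $1$ to $n$ in increasing order.
   Context: For $1\le i\le n$ and $v\in\mathrm{GF}(q)^n$ with $v_i\ne0$, let $S(i,v)$ be the $n\times n$ matrix obtained from the identity matrix $I_n$ by replacing its $i$-th row by $v$ (an invertible linear instruction updating row $i$; it may be the identity). Left multiplication of a matrix by $S(i,v)$ modifies only its $i$-th row. A nonsingular matrix $M$ can be computed by updating its rows from $1$ to $n$ in increasing order if there are $v^1,\dots,v^n\in\mathrm{GF}(q)^n$ with $v^i_i\neq0$ for all $i$ such that $M=S(n,v^n)\cdots S(2,v^2)S(1,v^1)$; equivalently, if there is a sequence of nonsingular matrices $N_0=I_n,N_1,\dots,N_n=M$ where $N_{i-1}$ and $N_i$ differ at most in row $i$, for $1\le i\le n$. *)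

(* Defs.v *)
From HB Require Import structures.
From mathcomp Require Import all_boot all_order all_algebra.

Set Implicit Arguments.
Unset Strict Implicit.
Unset Printing Implicit Defensive.

Import GRing.Theory.
Local Open Scope ring_scope.

(* S(i, v). It is an instruction (i.e. invertible) only when v 0 i != 0; this
   side condition is required where it is used, in computable_in_order. *)
Definition row_update (F : finFieldType) (n : nat) (i : 'I_n) (v : 'rV[F]_n) :
    'M[F]_n :=
  \matrix_(k < n) (if k == i then v else row k 1%:M).

(* S(n, v^n) *m ... *m S(2, v^2) *m S(1, v^1): iterated products put their first
   factor leftmost, hence the reversal of the index. *)
Definition update_program (F : finFieldType) (n : nat)
    (v : {ffun 'I_n -> 'rV[F]_n}) : 'M[F]_n :=
  \big[mulmx/1%:M]_(i < n) row_update (rev_ord i) (v (rev_ord i)).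

Definition computable_in_order (F : finFieldType) (n : nat) (M : 'M[F]_n) :
    bool :=
  [exists v : {ffun 'I_n -> 'rV[F]_n},
    [forall i, v i 0 i != 0] && (M == update_program v)].

(* Main.v *)
Require Import Defs.
From HB Require Import structures.
From mathcomp Require Import all_boot all_order all_algebra.

Set Implicit Arguments.
Unset Strict Implicit.
Unset Printing Implicit Defensive.

Import GRing.Theory.
Local Open Scope ring_scope.

(** A program determines its instructions: the row updated last can be erased
    (reset to the corresponding row of the identity) without using the last
    instruction, which recovers the matrix [N] computed by the earlier ones; as
    [N] is invertible, the last instruction [w] is determined by [w *m N].
    Hence the computable matrices correspond to the square arrays of coefficients
    (row [i] being the vector of instruction [i]) with nonzero diagonal. *)

Lemma row_row_update_mul (F : finFieldType) (n m : nat) (i j : 'I_n)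
    (w : 'rV[F]_n) (N : 'M[F]_(n, m)) :
  row j (row_update i w *m N) = if j == i then w *m N else row j N.
Proof. by rewrite row_mul rowK; case: eqP => // _; rewrite -row_mul mul1mx. Qed.

(** The matrix [row_update i w] is a rank-one perturbation of the identity, so it acts on a row
    vector [x] only through the entry [x 0 i]. *)
Lemma mul_row_update (F : finFieldType) (n : nat) (i : 'I_n) (x w : 'rV[F]_n) :
  x *m row_update i w = x + x 0 i *: (w - delta_mx 0 i).
Proof.
have -> : row_update i w = 1%:M + delta_mx i 0 *m (w - delta_mx 0 i).
  apply/row_matrixP => k; rewrite rowK [RHS]raddfD /= row_mul row1.
  have -> : row k (delta_mx i 0) = (k == i)%:R%:M :> 'M[F]_1.
    by apply/rowP => a; rewrite !mxE ord1 !eqxx andbT.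
  rewrite mul_scalar_mx; case: eqP => [->|_]; last by rewrite scale0r addr0.
  by rewrite scale1r addrC subrK.
rewrite mulmxDr mulmx1 mulmxA -colE [col i x]mx11_scalar mul_scalar_mx.
by rewrite !mxE.
Qed.

Lemma row_update_unit (F : finFieldType) (n : nat) (i : 'I_n) (w : 'rV[F]_n) :
  w 0 i != 0 -> row_update i w \in unitmx.
Proof.
move=> wi; rewrite -row_free_unit; apply: inj_row_free => x.
rewrite mul_row_update => x0.
(* Entry [i] of the vanishing product is [x 0 i * w 0 i]. Once [x 0 i] is zero, the update fixes
   [x], hence [x] itself is zero. *)
have /eqP : x 0 i * w 0 i = 0.
  by move/rowP/(_ i): x0; rewrite !mxE !eqxx mulrBr mulr1 addrC subrK.
by rewrite mulf_eq0 (negPf wi) orbF => /eqP xi; move: x0; rewrite xi scale0r addr0.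
Qed.

(** Programs over arbitrary lists allow induction on the list; its head is the leftmost factor, that
    is, the instruction executed last. *)
Definition seq_program (F : finFieldType) (n : nat) (v : 'I_n -> 'rV[F]_n)
    (s : seq 'I_n) : 'M[F]_n :=
  \big[mulmx/1%:M]_(i <- s) row_update i (v i).

Lemma seq_program_unit (F : finFieldType) (n : nat) (v : 'I_n -> 'rV[F]_n) s :
  (forall i, v i 0 i != 0) -> seq_program v s \in unitmx.
Proof.
move=> v0; apply: (big_ind (fun A => A \in unitmx)) => [|A B uA uB|i _]; first exact: unitmx1.
  by rewrite unitmx_mul uA.
exact: row_update_unit.
Qed.

Lemma row_seq_program_notin (F : finFieldType) (n : nat)
    (v : 'I_n -> 'rV[F]_n) s j :
  j \notin s -> row j (seq_program v s) = row j 1%:M.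
Proof.
rewrite /seq_program; elim: s => [|i s IH]; first by rewrite big_nil.
by rewrite inE negb_or big_cons row_row_update_mul => /andP[/negPf-> /IH].
Qed.

Lemma seq_program_inj (F : finFieldType) (n : nat) (v v' : 'I_n -> 'rV[F]_n) s :
  uniq s -> (forall i, v i 0 i != 0) ->
  seq_program v s = seq_program v' s -> {in s, v =1 v'}.
Proof.
move=> us v0; elim: s us => [//|i s IH] /= /andP[is_ us].
rewrite /seq_program !big_cons -!/(seq_program _ _) => E.
have rowE j := congr1 (row j) E.
have Es : seq_program v s = seq_program v' s.
  (* The head changes only row [i]. In that row both tails still agree with the identity, as [i]
     does not recur in [s]. *)
  apply/row_matrixP => j; have := rowE j; rewrite !row_row_update_mul.
  by case: eqP => // -> _; rewrite !row_seq_program_notin.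
move=> j; rewrite inE => /predU1P[->|]; last exact: IH.
(* Row [i] now reads [v i *m N = v' i *m N], with the invertible [N = seq_program v s] to cancel. *)
have := rowE i; rewrite !row_row_update_mul eqxx -Es.
by apply: (can_inj (mulmxK _)); apply: seq_program_unit.
Qed.

Lemma update_programE (F : finFieldType) (n : nat) (v : {ffun 'I_n -> 'rV[F]_n}) :
  update_program v = seq_program v [seq rev_ord i | i <- enum 'I_n].
Proof. by rewrite /update_program /seq_program big_map enumT [index_enum _]unlock. Qed.

Lemma update_program_unit (F : finFieldType) (n : nat)
    (v : {ffun 'I_n -> 'rV[F]_n}) :
  (forall i, v i 0 i != 0) -> update_program v \in unitmx.
Proof. by rewrite update_programE; apply: seq_program_unit. Qed.

Lemma update_program_inj (F : finFieldType) (n : nat)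
    (v v' : {ffun 'I_n -> 'rV[F]_n}) :
  (forall i, v i 0 i != 0) -> update_program v = update_program v' -> v = v'.
Proof.
move=> v0; rewrite !update_programE => /seq_program_inj E; apply/ffunP => i.
apply: E => //; first by rewrite (map_inj_uniq rev_ord_inj) enum_uniq.
by rewrite -(rev_ordK i) map_f ?mem_enum.
Qed.

(** Stated entry by entry, so that [family] yields the admissible arrays and their number is a
    product over positions. *)
Definition nonzero_diag (F : finFieldType) (n : nat) (ij : 'I_n * 'I_n) : pred F :=
  [pred x | (ij.1 == ij.2) ==> (x != 0)].

Lemma card_nonzero_diag (F : finFieldType) (n : nat) :
  #|family (@nonzero_diag F n)| = ((#|F| - 1) ^ n * #|F| ^ (n * (n - 1)))%N.
Proof.
rewrite card_family foldrE big_map big_enum /=.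
rewrite -(pair_bigA _ (fun i j : 'I_n => #|@nonzero_diag F n (i, j)|)) /=.
(* Each row has one diagonal entry, with [#|F| - 1] choices, and [n - 1] unrestricted ones. *)
transitivity (\prod_(i < n) ((#|F| - 1) * #|F| ^ (n - 1)))%N; last first.
  by rewrite prod_nat_const card_ord expnMn -expnM mulnC [(_ * n)%N]mulnC mulnC.
apply: eq_bigr => i _; rewrite (bigD1 i) //=; congr (_ * _)%N.
  rewrite subn1 -(cardC1 (0 : F)); apply: eq_card => x.
  by rewrite !inE /= eqxx.
transitivity (\prod_(j < n | j != i) #|F|)%N.
  apply: eq_bigr => j /negPf ji; apply: eq_card => x.
  by rewrite !inE /= eq_sym ji.
by rewrite prod_nat_const (cardC1 i) card_ord subn1.
Qed.

Definition instructions (F : finFieldType) (n : nat) (f : {ffun 'I_n * 'I_n -> F}) :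
    {ffun 'I_n -> 'rV[F]_n} :=
  [ffun i => \row_j f (i, j)].

Lemma instructions_inj (F : finFieldType) (n : nat) : injective (@instructions F n).
Proof.
move=> f g /ffunP E; apply/ffunP => -[i j].
by have /rowP/(_ j) := E i; rewrite !ffunE !mxE.
Qed.

Lemma instructions_diag (F : finFieldType) (n : nat) (f : {ffun 'I_n * 'I_n -> F}) :
  f \in family (@nonzero_diag F n) -> forall i, instructions f i 0 i != 0.
Proof.
by move=> /familyP f0 i; have := f0 (i, i); rewrite inE /= eqxx ffunE mxE.
Qed.

Lemma card_computable_in_order (F : finFieldType) (n : nat) :
  #|[set M : 'M[F]_n | (M \in unitmx) && computable_in_order M]|
    = ((#|F| - 1) ^ n * #|F| ^ (n * (n - 1)))%N.
Proof.
rewrite -card_nonzero_diag.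
(* The set to be counted is the image of the admissible arrays under a map that is injective on
   them. *)
rewrite -(@card_in_imset _ _ (fun f => update_program (@instructions F n f))).
  apply: eq_card => M; rewrite inE; apply/andP/imsetP.
    case=> _ /existsP[v /andP[/forallP v0 /eqP ->]].
    exists [ffun ij => v ij.1 0 ij.2].
      apply/familyP => -[i j]; rewrite ffunE inE /=.
      by apply/implyP => /eqP <-; apply: v0.
    congr update_program; apply/ffunP => i; apply/rowP => j.
    by rewrite !ffunE mxE ffunE.
  case=> f /instructions_diag f0 ->; split; first exact: update_program_unit.
  by apply/existsP; exists (instructions f); rewrite eqxx andbT; apply/forallP.
move=> f g /instructions_diag f0 _ /(update_program_inj f0).
exact: instructions_inj.
Qed.

Theorem proposition5 (p k q : nat) (p_prime : prime p) (k_gt0 : (0 < k)%N)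
    (q_def : q = (p ^ k)%N) (F : finFieldType) (cardF : #|F| = q)
    (n : nat) (n_ge2 : (2 <= n)%N) :
  #|[set M : 'M[F]_n | (M \in unitmx) && computable_in_order M]|
    = ((q - 1) ^ n * q ^ (n * (n - 1)))%N
  /\ ((q - 1) ^ n * q ^ (n * (n - 1)))%N%:R
    = (1 - 1 / q%:R) ^+ n * q%:R ^+ (n ^ 2) :> rat.
Proof.
split; first by rewrite -cardF card_computable_in_order.
have q_gt0 : (0 < q)%N by rewrite q_def expn_gt0 prime_gt0.
have q_neq0 : q%:R != 0 :> rat by rewrite Num.Theory.pnatr_eq0 -lt0n.
(* Splitting off [n] factors [q] lets each one absorb a factor [1 - 1 / q], giving [q - 1]. The
   truncated [n - 1] is harmless as [n] is positive. *)
have -> : (n ^ 2 = n + n * (n - 1))%N.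
  by rewrite -mulnS subn1 prednK ?mulnn // (ltn_trans _ n_ge2).
rewrite exprD mulrA -exprMn mulrBl !mul1r mulVf //.
by rewrite natrM !natrX natrB.
Qed.
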